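(* Let $c(m,n)=\frac1n C(m,n)$ be the maximum noiseless sum capacity per user. For any $\zeta>0$ and any sequences of positive integers $m_i\to\infty$, $n_i\to\infty$ with $\dfrac{n_i}{m_i\log_2 n_i}\to\zeta$, $$\liminf_{i\to\infty} c(m_i,n_i)\;\ge\;\min\left\{1,\frac1{2\zeta}\right\}.$$
   Context: Let $\mathcal M_{m\times n}(\pm1)$ be the set of $m\times n$ matrices with entries in $\{+1,-1\}$. For $A\in\mathcal M_{m\times n}(\pm1)$ the noiseless binary CDMA channel has input $X=(X_1,\dots,X_n)^T$ with $X_i\in\{\pm1\}$ and output $Y=\frac{1}{\sqrt m}AX$. Its sum capacity is $C(A)=\max I(X;Y)$, where $I$ is mutual information in bits (base-2 logarithms) and the maximum is over all product distributions of $X$ on $\{\pm1\}^n$ (i.e. $X_1,\dots,X_n$ independent). $C(m,n)=\max_{A\in\mathcal M_{m\times n}(\pm1)}C(A)$. *)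

(* Defs.v *)
From mathcomp Require Import all_boot all_order all_algebra.
From mathcomp Require Import all_classical all_reals all_analysis.

Set Implicit Arguments.
Unset Strict Implicit.
Unset Printing Implicit Defensive.

Import Order.TTheory GRing.Theory Num.Theory.
Import numFieldNormedType.Exports.

Local Open Scope classical_set_scope.
Local Open Scope ring_scope.

(* The library sets ln x = 0 for x <= 0, hence log2 0 = 0. *)
Definition log2 {R : realType} (x : R) : R := ln x / ln 2.

Definition is_pmf {R : realType} {T : finType} (p : T -> R) : Prop :=
  (forall t, 0 <= p t) /\ \sum_(t : T) p t = 1.

Section MutualInformation.
Context {R : realType} {Omega : finType}.
Implicit Type P : Omega -> R.

Definition law P {U : eqType} (X : Omega -> U) (u : U) : R :=
  \sum_(w : Omega | X w == u) P w.

(* In bits. The ranges of X and Y are finite because Omega is, and terms of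
   zero joint probability vanish, so that 0 * log2 0 = 0. *)
Definition mutual_info P {U V : eqType} (X : Omega -> U) (Y : Omega -> V) : R :=
  \sum_(u <- undup (codom X)) \sum_(v <- undup (codom Y))
    let puv := law P (fun w => (X w, Y w)) (u, v) in
    puv * log2 (puv / (law P X u * law P Y v)).

End MutualInformation.

Section CDMA.
Context {R : realType}.

(* A vector of {+1,-1}^n is coded by the Boolean function marking its
   coordinates equal to -1. *)
Definition cdma_input {n : nat} (w : {ffun 'I_n -> bool}) : 'cV[R]_n :=
  \col_(i < n) (-1) ^+ w i.

Definition cdma_output {m n : nat} (A : 'M[R]_(m, n))
    (w : {ffun 'I_n -> bool}) : 'cV[R]_m :=
  (Num.sqrt m%:R)^-1 *: (A *m cdma_input w).

Definition product_pmf {n : nat} (p : 'I_n -> bool -> R)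
    (w : {ffun 'I_n -> bool}) : R :=
  \prod_(i < n) p i (w i).

(* The supremum is a maximum: mutual information is continuous on the compact
   set of product distributions. *)
Definition sum_capacity {m n : nat} (A : 'M[R]_(m, n)) : R :=
  sup [set mutual_info (product_pmf p) cdma_input (cdma_output A)
      | p in [set p : 'I_n -> bool -> R | forall i, is_pmf (p i)]].

Definition is_sign_matrix {m n : nat} (A : 'M[R]_(m, n)) : Prop :=
  forall i j, A i j = 1 \/ A i j = -1.

(* A maximum, since there are finitely many sign matrices. *)
Definition max_sum_capacity (m n : nat) : R :=
  sup [set sum_capacity A | A in [set A : 'M[R]_(m, n) | is_sign_matrix A]].

Definition capacity_per_user (m n : nat) : R := max_sum_capacity m n / n%:R.

End CDMA.

(* Main.v *)
(* Random coding with uniform inputs. Since the channel is noiseless, the mutual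
   information is the entropy of the output, hence at least - log2 of the
   probability that two independent uniform inputs collide. A uniformly random
   sign matrix makes two inputs at even distance d collide with probability
   ('C(d, d/2) / 2^d)^m <= (d + 1)^(- m / 2), and never if d is odd. Distances
   below delta * n carry a fraction 2^(- n (1 - o(1))) of the pairs as
   delta -> 0, and the other ones contribute at most (delta * n)^(- m / 2),
   whose logarithm is equivalent to - m log2 n / 2, i.e. to - n / (2 zeta). *)

Require Import Defs.
From mathcomp Require Import all_boot all_order all_algebra.
From mathcomp Require Import all_classical all_reals all_analysis.
From mathcomp Require Import zify ring lra.
Import Order.TTheory GRing.Theory Num.Theory.
Import numFieldNormedType.Exports.
Local Open Scope classical_set_scope.
Local Open Scope ring_scope.

(** * Subsets that bisect a given set *)

(** Induction on [j]: (j + 1) C(2j + 2, j + 1) = 2 (2j + 1) C(2j, j), and (2j + 1)(2j + 3) <= (2j +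
    2)^2. Squaring keeps the square root out of [nat]. *)
Lemma central_binomial_le (j : nat) :
  ('C(j.*2, j) ^ 2 * j.*2.+1 <= 16 ^ j)%N.
Proof.
elim: j => [|j IHj]; first by [].
have rec : ('C(j.+1.*2, j.+1) * j.+1 = 2 * j.*2.+1 * 'C(j.*2, j))%N.
  have h1 := mul_bin_diag j.+1.*2 j.
  have h2 := mul_bin_down j.*2.+1 j.
  rewrite doubleS /= in h1 h2 *.
  have e : (j.*2.+1 - j = j.+1)%N by lia.
  rewrite e in h2.
  by nia.
rewrite -(leq_pmul2r (_ : 0 < j.+1 ^ 2)%N) ?expn_gt0//.
have -> : ('C(j.+1.*2, j.+1) ^ 2 * j.+1.*2.+1 * j.+1 ^ 2 =
    ('C(j.+1.*2, j.+1) * j.+1) ^ 2 * j.+1.*2.+1)%N by rewrite expnMn mulnAC.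
rewrite rec (expnS 16).
have -> : ((2 * j.*2.+1 * 'C(j.*2, j)) ^ 2 * j.+1.*2.+1 =
  ('C(j.*2, j) ^ 2 * j.*2.+1) * (4 * (j.*2.+1 * j.+1.*2.+1)))%N.
  by rewrite -!mulnn; lia.
rewrite [X in (_ <= X)%N](_ : _ = 16 ^ j * (16 * j.+1 ^ 2))%N; last by lia.
by apply: leq_mul => //; nia.
Qed.

(** [C] is determined by its traces on [D], a [j]-subset, and on the complement of [D]. *)
Lemma card_setI_eq_le (T : finType) (D : {set T}) (j : nat) :
  (#|[set C : {set T} | #|C :&: D| == j]%SET|
     <= 'C(#|D|, j) * 2 ^ (#|T| - #|D|))%N.
Proof.
pose f (C : {set T}) := (C :&: D, C :\: D)%SET.
have f_inj : injective f.
  by move=> C C' [e1 e2]; rewrite -(finset.setID C D) e1 e2 finset.setID.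
have <- : #|~: D|%SET = (#|T| - #|D|)%N by rewrite cardsCs finset.setCK.
rewrite -(card_imset _ f_inj) -card_powerset -cards_draws -cardsX.
apply/subset_leq_card/fintype.subsetP => _ /imsetP[C + ->].
rewrite !inE => ->; rewrite finset.subsetIr; apply/fintype.subsetP => x.
by rewrite !inE => /andP[].
Qed.

(** For odd |D| no subset bisects [D]; for |D| = 2j at most C(2j, j) 2^(|T| - 2j) do. In terms of
    probability, the bound is (|D| + 1)^(-1/2). *)
Lemma card_balanced_le (T : finType) (D : {set T}) :
  (#|[set C : {set T} | #|C :&: D|.*2 == #|D|]%SET| ^ 2 * #|D|.+1 <= 4 ^ #|T|)%N.
Proof.
have [Dodd|] := boolP (odd #|D|).
  rewrite (_ : [set C : {set T} | _]%SET = finset.set0) ?cards0//.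
  apply/setP => C; rewrite !inE; apply: contraTF Dodd => /eqP <-.
  by rewrite odd_double.
move=> /even_halfK; move: (_./2) => j De.
have -> : [set C : {set T} | (#|C :&: D|%SET).*2 == #|D|]%SET =
    [set C : {set T} | #|C :&: D|%SET == j]%SET.
  by apply/setP => C; rewrite !inE -De (inj_eq double_inj).
have le1 := card_setI_eq_le _ D j.
have le2 := central_binomial_le j.
have DT : (#|D| <= #|T|)%N by rewrite max_card.
apply: (@leq_trans (('C(#|D|, j) * 2 ^ (#|T| - #|D|)) ^ 2 * #|D|.+1)).
  by rewrite leq_mul2r leq_exp2r// le1 orbT.
rewrite expnMn mulnAC -{1 2}De.
have -> : (4 ^ #|T| = 16 ^ j * (2 ^ (#|T| - #|D|)) ^ 2)%N.
  rewrite -expnM (_ : 16 = 2 ^ 4)%N// (_ : 4 = 2 ^ 2)%N// -!expnM -expnD.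
  by congr (_ ^ _)%N; lia.
by rewrite leq_mul2r le2 orbT.
Qed.

(** * Mutual information and collision probability *)

Section MutualInformationBounds.
Context {R : realType}.

Lemma ln2_gt0 : 0 < ln 2 :> R.
Proof. by rewrite ln_gt0// ltr1n. Qed.

Context {Omega : finType} (P : Omega -> R) (P_pmf : is_pmf P).

Lemma law_ge0 (U : eqType) (X : Omega -> U) u : 0 <= law P X u.
Proof. by apply: sumr_ge0 => w _; apply: P_pmf.1. Qed.

Lemma law_pair_lel (U V : eqType) (X : Omega -> U) (Y : Omega -> V) u v :
  law P (fun w => (X w, Y w)) (u, v) <= law P X u.
Proof.
rewrite [leRHS](bigID (fun w => Y w == v))/= lerDl.
by apply: sumr_ge0 => w _; apply: P_pmf.1.
Qed.

Lemma law_pair_ler (U V : eqType) (X : Omega -> U) (Y : Omega -> V) u v :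
  law P (fun w => (X w, Y w)) (u, v) <= law P Y v.
Proof.
rewrite /law [leRHS](bigID (fun w => X w == u))/=.
rewrite (eq_bigl (fun w => (Y w == v) && (X w == u))).
  by rewrite lerDl; apply: sumr_ge0 => w _; apply: P_pmf.1.
by move=> w /=; rewrite xpair_eqE andbC.
Qed.

(* A crude bound, only there to make the suprema over product distributions
   and over sign matrices meaningful. *)
Lemma mutual_info_le (U V : eqType) (X : Omega -> U) (Y : Omega -> V) :
  mutual_info P X Y <= (#|Omega| ^ 2)%:R / ln 2.
Proof.
have term_le u v : let puv := law P (fun w => (X w, Y w)) (u, v) in
    puv * log2 (puv / (law P X u * law P Y v)) <= (ln 2)^-1.
  set p := law _ _ _ => /=.
  have: 0 <= p by exact: law_ge0.
  rewrite le_eqVlt => /predU1P[<-|p0].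
    by rewrite mul0r invr_ge0 ltW// ln2_gt0.
  have pu : p <= law P X u by exact: law_pair_lel.
  have pv : p <= law P Y v by exact: law_pair_ler.
  have pu0 := lt_le_trans p0 pu; have pv0 := lt_le_trans p0 pv.
  rewrite /log2 mulrA ler_pdivrMr ?ln2_gt0// mulVf ?gt_eqF ?ln2_gt0//.
  rewrite -(@mulfV _ p) ?gt_eqF// ler_pM2l//.
  have q0 : 0 < p / (law P X u * law P Y v) by rewrite divr_gt0 ?mulr_gt0.
  (* As ln q < q, it remains to see that p^2 is at most the product of the two marginals, each of
     which is at least p. *)
  apply: le_trans (ltW (ln_sublinear q0)) _.
  rewrite ler_pdivrMr ?mulr_gt0// mulrC ler_pdivlMr//.
  by rewrite ler_pM// ltW.
have size_codom (W : eqType) (Z : Omega -> W) :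
    (size (undup (codom Z)) <= #|Omega|)%N.
  by rewrite (leq_trans (size_undup _))// size_codom.
have sum_const (W : Type) (s : seq W) (c : R) :
    \sum_(x <- s) c = (size s)%:R * c.
  by rewrite big_const_seq count_predT iter_addr_0 mulr_natl.
rewrite /mutual_info; apply: le_trans (ler_sum _ _) _.
  by move=> u _; apply: ler_sum => v _; apply: term_le.
rewrite !sum_const mulrA -natrM ler_pM2r ?invr_gt0 ?ln2_gt0// ler_nat.
exact: leq_mul.
Qed.

(** Injectivity of [X] identifies its values with the outcomes [w], and only v = [Y w] survives in
    the inner sum. The factor [P w] stays uncancelled because it may vanish. *)
Lemma mutual_info_deterministic (U V : eqType) (X : Omega -> U) (Y : Omega -> V) :
  injective X ->
  mutual_info P X Y = \sum_w P w * log2 (P w / (P w * law P Y (Y w))).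
Proof.
move=> X_inj; rewrite /mutual_info undup_id; last by apply/injectiveP.
rewrite /codom /image_mem big_map big_enum /=; apply: eq_bigr => w _.
have lawX : law P X (X w) = P w.
  by rewrite /law (eq_bigl (pred1 w)) ?big_pred1_eq// => w' /=; rewrite inj_eq.
have lawXY v : law P (fun w => (X w, Y w)) (X w, v) = if Y w == v then P w else 0.
  rewrite /law (eq_bigl (fun w' => (Y w == v) && (w' == w))).
    by case: (Y w == v); rewrite ?big_pred1_eq ?big_pred0.
  move=> w' /=; rewrite xpair_eqE inj_eq// andbC.
  by case: (w' =P w) => [->|]; rewrite ?andbF.
rewrite (bigD1_seq (Y w)) ?undup_uniq ?mem_undup ?codom_f//=.
rewrite lawX lawXY eqxx big1 ?addr0// => v vY.
by rewrite lawXY eq_sym (negbTE vY) mul0r.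
Qed.

(* The mutual information is the entropy of Y, and the sum below is the
   collision probability of Y. *)
Lemma mutual_info_ge_collision (U V : eqType) (X : Omega -> U) (Y : Omega -> V)
    (s : R) :
  injective X -> 0 < s -> \sum_w P w * law P Y (Y w) <= s ->
  - log2 s <= mutual_info P X Y.
Proof.
move=> X_inj s0 les; rewrite mutual_info_deterministic//.
(* Jensen's inequality by a tangent line: with q = [law P Y (Y w)], ln (q / s) <= q / s - 1. On
   averaging over [w], the mean of 1 - q / s is nonnegative by [les]. *)
have ge w : P w * (- log2 s + (1 - law P Y (Y w) / s) / ln 2) <=
    P w * log2 (P w / (P w * law P Y (Y w))).
  have: 0 <= P w by exact: P_pmf.1.
  rewrite le_eqVlt => /predU1P[<-|Pw0]; first by rewrite !mul0r.
  have lY0 : 0 < law P Y (Y w).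
    apply: lt_le_trans Pw0 _; rewrite /law (bigD1 w)//= lerDl.
    by apply: sumr_ge0 => w' _; apply: P_pmf.1.
  rewrite ler_pM2l// invfM mulrA mulfV ?gt_eqF// mul1r /log2.
  rewrite -mulNr -mulrDl ler_pM2r ?invr_gt0 ?ln2_gt0//.
  have := le_ln1Dx (x := law P Y (Y w) / s - 1).
  have -> : 1 + (law P Y (Y w) / s - 1) = law P Y (Y w) / s by ring.
  have q0 : 0 < law P Y (Y w) / s by rewrite divr_gt0.
  rewrite ln_div ?posrE// lnV ?posrE// => h.
  by have := h (ltac:(lra)); lra.
apply: le_trans (ler_sum _ (fun w _ => ge w)).
have -> : \sum_w P w * (- log2 s + (1 - law P Y (Y w) / s) / ln 2) =
   (- log2 s + (ln 2)^-1) * (\sum_w P w) - (\sum_w P w * law P Y (Y w)) / s / ln 2.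
  rewrite mulr_sumr !mulr_suml -sumrB; apply: eq_bigr => w _.
  by ring.
rewrite P_pmf.2 mulr1 -addrA lerDl subr_ge0.
rewrite ler_pdivrMr ?ln2_gt0// mulVf ?gt_eqF ?ln2_gt0//.
by rewrite ler_pdivrMr// mul1r.
Qed.

End MutualInformationBounds.

(** * Random sign matrices and the coding bound *)

Lemma exists_le_mean (R : realFieldType) (T : finType) (t0 : T) (f : T -> R) (c : R) :
  \sum_t f t <= #|T|%:R * c -> exists t, f t <= c.
Proof.
move=> lec; case: (arg_minP f (isT : predT t0)) => t _ tmin; exists t.
have T0 : (0 < #|T|)%N by apply/card_gt0P; exists t0.
rewrite -(@ler_pM2l _ #|T|%:R) ?ltr0n//; apply: le_trans lec.
by rewrite mulr_natl -sumr_const; apply: ler_sum => t' _; apply: tmin.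
Qed.

Section RandomCoding.
Context {R : realType}.

Lemma cdma_input_inj n : injective (@cdma_input R n).
Proof.
move=> w w' /colP e; apply/ffunP => i.
by have := e i; rewrite !mxE => /signr_inj.
Qed.

Lemma product_pmf_is_pmf n (p : 'I_n -> bool -> R) :
  (forall i, is_pmf (p i)) -> is_pmf (product_pmf p).
Proof.
move=> p_pmf; split=> [w|].
  by apply: prodr_ge0 => i _; apply: (p_pmf i).1.
rewrite /product_pmf -bigA_distr_bigA big1// => i _.
exact: (p_pmf i).2.
Qed.

Lemma uniform_pmf : is_pmf (fun _ : bool => 2^-1 : R).
Proof. by split=> [b|]; rewrite ?invr_ge0 ?ler0n// big_bool/= [RHS]splitr div1r. Qed.

Lemma product_pmf_uniform n (w : {ffun 'I_n -> bool}) :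
  product_pmf (fun _ _ => 2^-1 : R) w = 2^-1 ^+ n.
Proof. by rewrite /product_pmf prodr_const card_ord. Qed.

Lemma mutual_info_le_max_sum_capacity m n (A : 'M[R]_(m, n)) (p : 'I_n -> bool -> R) :
  is_sign_matrix A -> (forall i, is_pmf (p i)) ->
  mutual_info (product_pmf p) (@cdma_input R n) (cdma_output A)
    <= max_sum_capacity (R := R) m n.
Proof.
move=> A_sign p_pmf.
(* [M] depends on [n] only, so it bounds the sets under both suprema. *)
set M := (#|{: {ffun 'I_n -> bool}}| ^ 2)%:R / ln 2 : R.
pose I (A : 'M[R]_(m, n)) :=
  [set mutual_info (product_pmf p) (@cdma_input R n) (cdma_output A)
    | p in [set p : 'I_n -> bool -> R | forall i, is_pmf (p i)]].
have I_le A' : ubound (I A') M.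
  by move=> _ [p' /= p'_pmf <-]; apply/mutual_info_le/product_pmf_is_pmf.
have cap_le (A' : 'M[R]_(m, n)) : sum_capacity A' <= M.
  rewrite /sum_capacity -/(I A'); apply: ge_sup (I_le A').
  by exists (mutual_info (product_pmf p) (@cdma_input R n) (cdma_output A')), p.
apply: (@le_trans _ _ (sum_capacity A)).
  by apply: (@ub_le_sup _ (I A)); [exists M; exact: I_le | exists p].
apply: ub_le_sup; last by exists A.
by exists M => _ [A' _ <-]; apply: cap_le.
Qed.

(** [b] codes a row of the matrix just as inputs are coded; [w] and [w'] collide when every row lies
    in this set. *)
Definition sign_collisions {n} (w w' : {ffun 'I_n -> bool}) :
    {set {ffun 'I_n -> bool}} :=
  [set b : {ffun 'I_n -> bool} |
    \sum_i (-1) ^+ b i * (-1) ^+ w i == \sum_i (-1) ^+ b i * (-1) ^+ w' i :> R]%SET.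

(** Let [D] be the set where [w] and [w'] differ. The two inner products agree off [D] and are
    opposite on [D], so a collision forces the signs b_i w_i to sum to 0 over [D]: the set where
    [b (+) w] holds bisects [D], and it determines [b]. *)
Lemma card_sign_collisions_le n (w w' : {ffun 'I_n -> bool}) :
  (#|sign_collisions w w'| ^ 2 * #|[set i | w i != w' i]%SET|.+1 <= 4 ^ n)%N.
Proof.
set D := [set i | _]%SET.
pose f (b : {ffun 'I_n -> bool}) := [set i | b i (+) w i]%SET.
have f_inj : injective f.
  move=> b b' /setP e; apply/ffunP => i; have := e i.
  by rewrite !inE => /addIb.
have := card_balanced_le _ D; rewrite card_ord; apply: leq_trans.
rewrite leq_mul2r leq_exp2r// -(card_imset _ f_inj) orbC.
rewrite (subset_leq_card (B := [set C : {set 'I_n} | #|C :&: D|.*2 == #|D|]%SET))//.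
apply/fintype.subsetP => _ /imsetP[b + ->]; rewrite !inE => /eqP eb.
have sumD : \sum_(i in D) (-1) ^+ (b i (+) w i) = 0 :> R.
  apply: (@mulfI _ 2); first by rewrite pnatr_eq0.
  rewrite mulr0 mulr_sumr.
  transitivity (\sum_i (-1) ^+ b i * (-1) ^+ w i
      - \sum_i (-1) ^+ b i * (-1) ^+ w' i : R);
    last by rewrite eb subrr.
  rewrite -sumrB [LHS]big_mkcond/=; apply: eq_bigr => i _; rewrite inE signr_addb.
  by case: (b i); case: (w i); case: (w' i); rewrite /= ?expr0 ?expr1; ring.
have : \sum_(i in D) (-1) ^+ (b i (+) w i) = #|D|%:R - (#|f b :&: D|%SET).*2%:R :> R.
  rewrite -muln2 natrM -sum1_card -[in RHS]sum1_card !natr_sum mulr_suml.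
  have fbD i : (i \in f b :&: D) = (i \in D) && (i \in f b) by rewrite inE andbC.
  rewrite [\sum_(i in f b :&: D) _](eq_bigl _ _ fbD) big_mkcondr -sumrB; apply: eq_bigr => i _; rewrite inE.
  by case: (b i (+) w i); rewrite /= ?expr0 ?expr1; ring.
move=> /eqP; rewrite sumD eq_sym subr_eq0 eqr_nat => /eqP ->.
by rewrite eqxx.
Qed.

Lemma sign_collisions_prob_le n (w w' : {ffun 'I_n -> bool}) :
  #|sign_collisions w w'|%:R / 2 ^+ n
    <= (Num.sqrt #|[set i | w i != w' i]%SET|.+1%:R)^-1 :> R.
Proof.
set d := #|_|.+1.
have d0 : 0 < Num.sqrt d%:R :> R by rewrite sqrtr_gt0 ltr0n.
rewrite -[leRHS]div1r ler_pdivlMr// mulrAC ler_pdivrMr ?exprn_gt0// mul1r.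
rewrite -(@ler_pXn2r _ 2)// ?nnegrE ?mulr_ge0 ?exprn_ge0 ?sqrtr_ge0 ?ler0n//.
rewrite exprMn sqr_sqrtr ?ler0n// -!natrX -natrM ler_nat.
have -> : ((2 ^ n) ^ 2 = 4 ^ n)%N by rewrite -expnM mulnC expnM.
exact: card_sign_collisions_le.
Qed.

(** Indexing by functions from rows to sign vectors turns a collision into membership in an
    [ffun_on], whose cardinality is an [m]-th power. *)
Definition sign_mx {m n} (B : {ffun 'I_m -> {ffun 'I_n -> bool}}) : 'M[R]_(m, n) :=
  \matrix_(r, i) (-1) ^+ B r i.

Lemma sign_mx_sign m n (B : {ffun 'I_m -> {ffun 'I_n -> bool}}) :
  is_sign_matrix (sign_mx B).
Proof. by move=> r i; rewrite mxE; case: (B r i); [right|left]. Qed.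

Lemma cdma_output_sign_mx_eq m n (B : {ffun 'I_m -> {ffun 'I_n -> bool}}) w w' :
  (0 < m)%N ->
  (cdma_output (sign_mx B) w == cdma_output (sign_mx B) w')
    = (B \in ffun_on (mem (sign_collisions w w'))).
Proof.
move=> m0; rewrite /cdma_output.
have sm0 : (Num.sqrt m%:R)^-1 != 0 :> R by rewrite invr_eq0 gt_eqF// sqrtr_gt0 ltr0n.
have mulE v r :
    (sign_mx B *m cdma_input v) r 0 = \sum_i (-1) ^+ B r i * (-1) ^+ v i :> R.
  by rewrite mxE; apply: eq_bigr => i _; rewrite !mxE.
rewrite (inj_eq (scalerI sm0)); apply/eqP/ffun_onP => [/colP e r|e].
  by rewrite inE -!mulE e.
by apply/colP => r; have := e r; rewrite inE -!mulE => /eqP.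
Qed.

(** The sum factors over coordinates: each contributes 1 for agreement and [t] for disagreement. *)
Lemma sum_hamming n (w : {ffun 'I_n -> bool}) (t : R) :
  \sum_(w' : {ffun 'I_n -> bool}) t ^+ #|[set i | w i != w' i]%SET| = (1 + t) ^+ n.
Proof.
transitivity (\prod_(i < n) \sum_(b : bool) (if w i != b then t else 1)).
  rewrite bigA_distr_bigA; apply: eq_bigr => w' _.
  rewrite -prodr_const big_mkcond/=; apply: eq_bigr => i _.
  by rewrite inE.
rewrite -[in RHS](card_ord n) -prodr_const; apply: eq_bigr => i _.
by rewrite big_bool; case: (w i) => //=; rewrite addrC.
Qed.

(* Averaging over all sign matrices: pairs of inputs at distance at most K are
   counted by the generating function t^(d - K), the other ones collide with
   probability at most (K + 1)^(- m / 2). *)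
Lemma random_coding_bound m n K (t : R) :
  (0 < m)%N -> 0 < t <= 1 ->
  - log2 (((1 + t) / 2) ^+ n / t ^+ K + (Num.sqrt K.+1%:R)^-1 ^+ m)
    <= max_sum_capacity (R := R) m n.
Proof.
move=> m0 /andP[t0 t1].
set sK := (Num.sqrt K.+1%:R)^-1 ^+ m; set S := _ / _ + sK.
have sK0 : 0 < sK by rewrite exprn_gt0// invr_gt0 sqrtr_gt0 ltr0n.
have S0 : 0 < S by rewrite addr_gt0// divr_gt0 ?exprn_gt0// divr_gt0// addr_gt0.
pose P := product_pmf (fun (_ : 'I_n) _ => 2^-1 : R).
have pair_le (w w' : {ffun 'I_n -> bool}) :
    (#|sign_collisions w w'|%:R / 2 ^+ n) ^+ m
      <= t ^+ #|[set i | w i != w' i]%SET| / t ^+ K + sK.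
  have q0 : 0 <= #|sign_collisions w w'|%:R / 2 ^+ n :> R.
    by rewrite divr_ge0 ?exprn_ge0.
  have := sign_collisions_prob_le _ w w'; set d := #|[set i | w i != w' i]%SET| => qd.
  (* For close pairs the probability is bounded by 1 <= t^d / t^K, using t <= 1; for distant ones
     [sK] suffices. *)
  have [dK|Kd] := leqP d K.
    apply: (@le_trans _ _ 1).
      rewrite exprn_ile1//; apply: le_trans qd _.
      rewrite invf_le1 ?sqrtr_gt0 ?ltr0n// -[leLHS]sqrtr1.
      by rewrite ler_sqrt ?ltr0n// ler1n.
    rewrite -[leLHS]addr0 lerD//; last exact: ltW.
    by rewrite ler_pdivlMr ?exprn_gt0// mul1r; apply: (ler_wiXn2l (ltW t0) t1).
  rewrite -[leLHS]add0r lerD//; first by rewrite divr_ge0 ?exprn_ge0// ?ltW.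
  rewrite lerXn2r ?nnegrE ?invr_ge0 ?sqrtr_ge0//; apply: le_trans qd _.
  rewrite lef_pV2 ?posrE ?sqrtr_gt0 ?ltr0n// ler_sqrt ?ltr0n//.
  by rewrite ler_nat ltnS ltnW.
pose s (B : {ffun 'I_m -> {ffun 'I_n -> bool}}) :=
  \sum_w P w * law P (cdma_output (sign_mx B)) (cdma_output (sign_mx B) w).
have [B sB] : exists B, s B <= S.
  apply: (exists_le_mean _ _ [ffun=> [ffun=> true]]).
  have cardB : #|{: {ffun 'I_m -> {ffun 'I_n -> bool}}}|%:R = (2 ^+ n) ^+ m :> R.
    by rewrite !card_ffun !card_ord card_bool !natrX.
  (* Sum over [B] first: for a fixed pair of inputs, the rows of a colliding matrix range
     independently over [sign_collisions]. *)
  have -> : \sum_B s B = 2^-1 ^+ n * 2^-1 ^+ n *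
      \sum_(w : {ffun 'I_n -> bool}) \sum_(w' : {ffun 'I_n -> bool})
        #|sign_collisions w' w|%:R ^+ m.
    rewrite /s exchange_big mulr_sumr; apply: eq_bigr => w _ /=.
    rewrite /law -mulr_sumr /P product_pmf_uniform -mulrA; congr (_ * _).
    transitivity (\sum_(B : {ffun 'I_m -> {ffun 'I_n -> bool}})
        \sum_(w' : {ffun 'I_n -> bool})
        (if B \in ffun_on (mem (sign_collisions w' w)) then 2^-1 ^+ n else 0 : R)).
      apply: eq_bigr => B _; rewrite big_mkcond/=; apply: eq_bigr => w' _.
      by rewrite cdma_output_sign_mx_eq// product_pmf_uniform.
    rewrite exchange_big mulr_sumr; apply: eq_bigr => w' _ /=.
    rewrite -big_mkcond/= sumr_const card_ffun_on card_ord.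
    by rewrite -natrX mulr_natr.
  rewrite cardB.
  have -> : 2^-1 ^+ n * 2^-1 ^+ n *
        \sum_(w : {ffun 'I_n -> bool}) \sum_(w' : {ffun 'I_n -> bool})
          #|sign_collisions w' w|%:R ^+ m
      = (2 ^+ n) ^+ m * (2^-1 ^+ n * 2^-1 ^+ n *
        \sum_(w : {ffun 'I_n -> bool}) \sum_(w' : {ffun 'I_n -> bool})
          (#|sign_collisions w' w|%:R / 2 ^+ n) ^+ m) :> R.
    rewrite mulrCA; congr (_ * _); rewrite mulr_sumr; apply: eq_bigr => w _.
    rewrite mulr_sumr; apply: eq_bigr => w' _.
    by rewrite -exprMn mulrC divfK// expf_neq0// pnatr_eq0.
  rewrite ler_pM2l ?exprn_gt0//.
  have h2n : 2^-1 ^+ n != 0 :> R by rewrite expf_neq0// invr_eq0 pnatr_eq0.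
  have cardw : #|{: {ffun 'I_n -> bool}}|%:R = (2^-1 ^+ n)^-1 :> R.
    by rewrite card_ffun card_ord card_bool natrX exprVn invrK.
  (* [S] is exactly the average over all pairs of the bound in [pair_le], by [sum_hamming]. *)
  have -> : S = 2^-1 ^+ n * 2^-1 ^+ n *
      \sum_(w : {ffun 'I_n -> bool}) \sum_(w' : {ffun 'I_n -> bool})
        (t ^+ #|[set i | w' i != w i]%SET| / t ^+ K + sK).
    rewrite exchange_big/=.
    under eq_bigr do rewrite big_split/= -mulr_suml sum_hamming sumr_const
      -[sK *+ _]mulr_natr cardw.
    rewrite sumr_const -[(_ + _) *+ _]mulr_natr cardw /S exprMn.
    have tK0 : t ^+ K != 0 by rewrite expf_neq0// gt_eqF.
    move: (2^-1 ^+ n) ((1 + t) ^+ n) (t ^+ K) sK h2n tK0 {S S0 sK0 pair_le cardw}.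
    by move=> h a b c h0 b0; field; rewrite h0 b0.
  rewrite ler_wpM2l ?mulr_ge0 ?exprn_ge0 ?invr_ge0//.
  by apply: ler_sum => w _; apply: ler_sum => w' _; apply: pair_le.
apply: le_trans (mutual_info_le_max_sum_capacity _ _ _ _
  (sign_mx_sign _ _ B) (fun=> uniform_pmf)).
apply: mutual_info_ge_collision => //; last exact: cdma_input_inj.
exact: product_pmf_is_pmf (fun=> uniform_pmf).
Qed.

End RandomCoding.

(** * Asymptotics of the bound *)

Lemma limn_einf_ge (R : realType) (u : nat -> \bar R) (l : \bar R) :
  (\forall i \near \oo, (l <= u i)%E) -> (l <= limn_einf u)%E.
Proof.
move=> [N _ lu]; rewrite limn_einf_lim; apply: lime_ge; first exact: is_cvg_einfs.
exists N => // n /= Nn; apply: le_ereal_inf_tmp => _ [k /= nk <-].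
by apply: lu; apply: leq_trans nk.
Qed.

Section Asymptotics.
Context {R : realType}.

(** The sum is at most twice the larger term, which costs one bit; per user this is the negligible 1
    / n below. *)
Lemma log2_add_le (a b c : R) : 0 < a -> 0 < b ->
  c <= - log2 a -> c <= - log2 b -> c - 1 <= - log2 (a + b).
Proof.
move=> a0 b0; wlog : a b a0 b0 / b <= a => [wl|ba ca cb].
  move=> ca cb; have [ba|/ltW ab] := leP b a; [|rewrite (addrC a)]; exact: wl.
have : ln (a + b) <= ln 2 + ln a.
  rewrite -lnM ?posrE// ler_ln ?posrE ?addr_gt0 ?mulr_gt0//.
  by rewrite mulr2n mulrDl mul1r lerD2l.
have ln2_0 := ln2_gt0 (R := R).
move: ca; rewrite /log2 -!mulNr !ler_pdivlMr// => ca h.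
by lra.
Qed.

(** The entries of the minimum are lower bounds, per user, for the exponents of the two terms of
    [random_coding_bound]: close pairs, through ln (1 + t) <= t, and distant pairs. *)
Lemma capacity_per_user_ge (m n : nat) (t delta : R) :
  (0 < m)%N -> (0 < n)%N -> 0 < t <= 1 -> 0 < delta ->
  Num.min (1 - (t - delta * ln t) / ln 2)
    (m%:R * log2 n%:R / n%:R / 2 + m%:R / n%:R * log2 delta / 2) - n%:R^-1
    <= capacity_per_user (R := R) m n.
Proof.
move=> m0 n0 /andP[t0 t1] d0; set c := Num.min _ _.
have nR0 : 0 < n%:R :> R by rewrite ltr0n.
have mR0 : 0 < m%:R :> R by rewrite ltr0n.
have ln2_0 := ln2_gt0 (R := R).
rewrite /capacity_per_user ler_pdivlMr// mulrBl mulVf ?gt_eqF//.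
(* K <= delta n serves the close pairs, where ln t <= 0; delta n < K + 1 serves the distant ones. *)
set K := Num.truncn (delta * n%:R).
have /andP[Kle ltK] : K%:R <= delta * n%:R < K.+1%:R.
  by rewrite truncn_itv// mulr_ge0// ltW.
have t01 : 0 < t <= 1 by rewrite t0.
apply: le_trans (random_coding_bound m n K t m0 t01).
have h0 : 0 < (1 + t) / 2 by rewrite divr_gt0// addr_gt0.
have s0 : 0 < Num.sqrt K.+1%:R :> R by rewrite sqrtr_gt0 ltr0n.
apply: log2_add_le.
- by rewrite divr_gt0 ?exprn_gt0.
- by rewrite exprn_gt0// invr_gt0.
- apply: (@le_trans _ _ ((1 - (t - delta * ln t) / ln 2) * n%:R)).
    by rewrite ler_pM2r// /c ge_min lexx.
  rewrite /log2 ln_div ?posrE ?exprn_gt0// !lnXn// ln_div ?posrE ?addr_gt0//.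
  rewrite -[leRHS]mulNr ler_pdivlMr// -[(_ - _) *+ n]mulr_natr -[ln t *+ K]mulr_natr.
  have -> : (1 - (t - delta * ln t) / ln 2) * n%:R * ln 2
      = (ln 2 - t + delta * ln t) * n%:R by field; rewrite gt_eqF.
  have lnt0 : ln t <= 0 by rewrite ln_le0.
  have ln1t : ln (1 + t) <= t by rewrite le_ln1Dx// (lt_trans _ t0)// ltrN10.
  have h1 : ln (1 + t) * n%:R <= t * n%:R by rewrite ler_pM2r.
  have h2 : ln t * (delta * n%:R) <= ln t * K%:R by rewrite ler_wnM2l.
  by lra.
- apply: (@le_trans _ _ ((m%:R * log2 n%:R / n%:R / 2
      + m%:R / n%:R * log2 delta / 2) * n%:R)).
    by rewrite ler_pM2r// /c ge_min lexx orbT.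
  have lnK : ln delta + ln n%:R <= ln (Num.sqrt K.+1%:R) *+ 2 :> R.
    rewrite -lnXn// sqr_sqrtr ?ler0n// -lnM ?posrE//.
    by rewrite ler_ln ?posrE ?mulr_gt0// ?ltr0n// ltW.
  rewrite /log2 lnXn ?invr_gt0// lnV ?posrE// -[(- _) *+ m]mulr_natr.
  rewrite -[leRHS]mulNr ler_pdivlMr//.
  have -> : (m%:R * (ln n%:R / ln 2) / n%:R / 2 + m%:R / n%:R * (ln delta / ln 2) / 2)
      * n%:R * ln 2 = m%:R * (ln n%:R + ln delta) / 2 :> R.
    by field; rewrite !gt_eqF.
  have : m%:R * (ln delta + ln n%:R) <= m%:R * (ln (Num.sqrt K.+1%:R) *+ 2).
    by rewrite ler_pM2l.
  by rewrite mulr2n; lra.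
Qed.

Lemma log2_cvgy (n : nat -> nat) :
  n i @[i --> \oo] --> \oo -> (log2 (n i)%:R : R) @[i --> \oo] --> +oo.
Proof.
move=> /(cvgrnyP (R := R)) n_cvg; apply/cvgryPge => A.
near=> i; rewrite /log2 ler_pdivlMr ?ln2_gt0//.
have ni : expR (A * ln 2) <= (n i)%:R by near: i; exact: (cvgry_ge n_cvg).
by rewrite -ler_expR lnK// posrE (lt_le_trans (expR_gt0 _) ni).
Unshelve. all: by end_near. Qed.

Lemma exists_parameters (e : R) : 0 < e ->
  exists t delta : R, [/\ 0 < t <= 1, 0 < delta & (t - delta * ln t) / ln 2 <= e].
Proof.
move=> e0; have ln2_0 := ln2_gt0 (R := R).
have h0 : 0 < e * ln 2 / 2 by rewrite divr_gt0// mulr_gt0.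
set t := Num.min 1 (e * ln 2 / 2).
have t0 : 0 < t by rewrite lt_min ltr01.
have lnt : ln t <= 0 by rewrite ln_le0// ge_min lexx.
(* [t] is fixed first, then [delta] is made small enough to absorb - ln t. Dividing by 1 - ln t
   rather than - ln t covers the case t = 1. *)
have l0 : 0 < 1 - ln t by rewrite subr_gt0 (le_lt_trans lnt).
exists t, (e * ln 2 / 2 / (1 - ln t)); split.
- by rewrite t0 ge_min lexx.
- by rewrite divr_gt0.
rewrite ler_pdivrMr//.
have tle : t <= e * ln 2 / 2 by rewrite ge_min lexx orbT.
have : e * ln 2 / 2 / (1 - ln t) * - ln t <= e * ln 2 / 2.
  rewrite mulrAC ler_pdivrMr// ler_pM2l//; lra.
rewrite mulrN; lra.
Qed.

End Asymptotics.

(** * Passage to the limit *)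

Theorem theorem3 (R : realType) (zeta : R) (m n : nat -> nat)
    (zeta_gt0 : 0 < zeta)
    (m_gt0 : forall i, (0 < m i)%N) (n_gt0 : forall i, (0 < n i)%N)
    (m_cvg : m i @[i --> \oo] --> \oo) (n_cvg : n i @[i --> \oo] --> \oo)
    (ratio_cvg :
       (n i)%:R / ((m i)%:R * log2 (n i)%:R) @[i --> \oo] --> zeta) :
  ((Num.min 1 (1 / (2 * zeta)))%:E
     <= limn_einf (fun i => (@capacity_per_user R (m i) (n i))%:E))%E.
Proof.
apply/lee_addgt0Pr => e e0; rewrite -leeBlDr// -EFinB.
have e2 : 0 < e / 2 by rewrite divr_gt0.
have [t [delta [t01 d0 tde]]] := exists_parameters _ e2.
have log_cvg := log2_cvgy n n_cvg (R := R).
have log_gt0 : \forall i \near \oo, 0 < log2 (n i)%:R :> R by exact: cvgry_gt.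
have rate_cvg : (m i)%:R * log2 (n i)%:R / (n i)%:R @[i --> \oo] --> zeta^-1.
  under eq_fun do rewrite -invf_div.
  by apply: cvgV => //; rewrite gt_eqF.
(* m / n is the rate m log2 n / n, which converges, divided by log2 n, which diverges. Hence the
   term in [log2 delta] disappears in the limit, [delta] being fixed. *)
have load_cvg : (m i)%:R / (n i)%:R @[i --> \oo] --> (0 : R).
  rewrite -(mulr0 zeta^-1).
  apply: cvg_trans (cvgM rate_cvg ((gtr0_cvgV0 log_gt0).2 log_cvg)).
  apply: near_eq_cvg.
  near=> i => /=; rewrite mulrAC mulfK// gt_eqF//.
  by near: i.
have bound_cvg : (m i)%:R * log2 (n i)%:R / (n i)%:R / 2
    + (m i)%:R / (n i)%:R * log2 delta / 2 @[i --> \oo] --> 1 / (2 * zeta).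
  have -> : 1 / (2 * zeta) = zeta^-1 / 2 + 0 * log2 delta / 2.
    by field; rewrite gt_eqF.
  exact: cvgD (cvgMr_tmp rate_cvg) (cvgMr_tmp (cvgMr_tmp load_cvg)).
apply: limn_einf_ge; near=> i; rewrite lee_fin.
apply: le_trans (capacity_per_user_ge (m i) (n i) t delta _ _ t01 d0) => //.
have n_le : (n i)%:R^-1 <= e / 2.
  rewrite -[e / 2]invrK lef_pV2 ?posrE ?invr_gt0 ?ltr0n//.
  by near: i; apply: cvgry_ge; apply/cvgrnyP.
have b_ge : 1 / (2 * zeta) - e / 2 <= (m i)%:R * log2 (n i)%:R / (n i)%:R / 2
    + (m i)%:R / (n i)%:R * log2 delta / 2.
  by near: i; apply: cvgr_ge bound_cvg _ _; rewrite ltrBlDr ltrDl.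
(* One half of [e] pays for 1 / n. The other is the loss in the minimum: by the choice of [t] and
   [delta] in its first entry, by convergence in its second. *)
rewrite [e in leLHS]splitr opprD addrA lerD ?lerN2//.
by rewrite le_min !lerBlDr !ge_min; apply/andP; split; apply/orP; [left|right]; lra.
Unshelve. all: by end_near. Qed.
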